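(* Let $A$ be a continuous dcpo. For $x\in A$ let $C_x=\{y\in A\mid y\sqsubseteq x\}$, $I_x=\{y\in A\mid\{x,y\}\text{ has no upper bound in }A\}$ and $J_x=\{y\in A\mid x\in\mathrm{Int}(I_y)\}$. Then $A$ satisfies the Lawson condition if and only if $J_x=I_x$ for all $x\in\mathrm{Total}(A)$. Hence, if the Lawson condition holds, then $C_x\cup J_x=C_x\cup\mathrm{Int}(J_x)=A$ for all $x\in\mathrm{Total}(A)$.
   Context: Directed sets are nonempty. A dcpo is a poset with least element in which every directed subset has a least upper bound. $x\ll y$ means: for every directed $S$ with $y\sqsubseteq\sqcup S$ there is $s\in S$ with $x\sqsubseteq s$. A dcpo $A$ is continuous (with basis $K\subseteq A$) if for every $a\in A$ the set $\{k\in K\mid k\ll a\}$ is directed with supremum $a$. $U\subseteq A$ is Scott open if it is upward closed and meets every directed $S$ with $\sqcup S\in U$; $\mathrm{Int}$ is interior in the Scott topology. $\mathrm{Total}(A)$ is the set of maximal elements of $A$. The Lawson topology on $A$ is generated by the Scott open sets and the sets $A\setminus\{z\mid y\sqsubseteq z\}$, $y\in A$. The Lawson condition: the relative Scott topology and the relative Lawson topology on $\mathrm{Total}(A)$ are equal. *)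

(* Defs.v *)
From HB Require Import structures.
From mathcomp Require Import all_boot all_order.
From mathcomp Require Import wochoice all_classical topology.

Set Implicit Arguments.
Unset Strict Implicit.
Unset Printing Implicit Defensive.

Import Order.TTheory.

Local Open Scope order_scope.
Local Open Scope classical_set_scope.

(* Classically every poset carries the decidable equality, the choice operator
   and the boolean-valued order that [porderType] asks for, so quantifying over
   [porderType] or [bPOrderType] is quantifying over all posets (with bottom). *)

Section Domains.
Context {d : Order.disp_t} {A : porderType d}.
Implicit Types (S U K : set A) (x y z a : A).

Definition directed S :=
  S !=set0 /\ forall x y, S x -> S y -> exists z, [/\ S z, x <= z & y <= z].

Definition way_below x y :=
  forall S s, directed S -> supremums S s -> y <= s ->
    exists2 t, S t & x <= t.

Definition domain_basis K :=
  forall a, let Ka := [set k | K k /\ way_below k a] in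
    directed Ka /\ supremums Ka a.

Definition scott_open U :=
  (forall x y, U x -> x <= y -> U y) /\
  (forall S s, directed S -> supremums S s -> U s -> (S `&` U) !=set0).

Definition lawson_subbasis U :=
  scott_open U \/ exists y, U = ~` [set z | y <= z].

Definition total_elements : set A := [set x | maximal <=%O x].

Lemma scott_openT : scott_open setT.
Proof. by split=> // S s [[t St] _] _ _; exists t. Qed.

Lemma scott_openI : setI_closed scott_open.
Proof.
move=> U V [upU dirU] [upV dirV]; split=> [x y [Ux Vx] xy|S s dS sS [Us Vs]].
  by split; [exact: upU xy|exact: upV xy].
have [t [St Ut]] := dirU _ _ dS sS Us; have [u [Su Vu]] := dirV _ _ dS sS Vs.
have [v [Sv tv uv]] := dS.2 _ _ St Su.
by exists v; split=> //; split; [exact: upU tv|exact: upV uv].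
Qed.

Lemma scott_open_bigU (I : Type) (f : I -> set A) :
  (forall i, scott_open (f i)) -> scott_open (\bigcup_i f i).
Proof.
move=> of_; split=> [x y [i _ fix_] xy|S s dS sS [i _ fis]].
  by exists i => //; exact: (of_ i).1 xy.
have [t [St fit]] := (of_ i).2 _ _ dS sS fis.
by exists t; split=> //; exists i.
Qed.

End Domains.

Arguments total_elements {d} A.

(* Copies of a poset that carry the Scott and the Lawson topology. *)
Definition scott_topology (T : Type) : Type := T.
Definition lawson_topology (T : Type) : Type := T.

HB.instance Definition _ (d : Order.disp_t) (A : porderType d) :=
  Choice.copy (scott_topology A) A.
HB.instance Definition _ (d : Order.disp_t) (A : porderType d) :=
  isOpenTopological.Build (scott_topology A)
    (@scott_openT d A) (@scott_openI d A) (@scott_open_bigU d A).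

HB.instance Definition _ (d : Order.disp_t) (A : porderType d) :=
  Choice.copy (lawson_topology A) A.
HB.instance Definition _ (d : Order.disp_t) (A : porderType d) :=
  @isSubBaseTopological.Build (lawson_topology A)
    (set A) (@lawson_subbasis d A) id.

Lemma open_scottE (d : Order.disp_t) (A : porderType d) :
  @open (scott_topology A) = @scott_open d A.
Proof. by []. Qed.

Definition dcpo (d : Order.disp_t) (A : bPOrderType d) :=
  forall S : set A, directed S -> supremums S !=set0.

Definition continuous_dcpo (d : Order.disp_t) (A : bPOrderType d) :=
  dcpo A /\ exists K : set A, domain_basis K.

(* The two sides are the subtype topologies inherited by the maximal elements
   from the two copies of [A]; the carriers are convertible. *)
Definition lawson_condition (d : Order.disp_t) (A : porderType d) :=
  @open (set_type (total_elements A : set (scott_topology A))) =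
  @open (set_type (total_elements A : set (lawson_topology A))).

Section ConsistencySets.
Context {d : Order.disp_t} {A : porderType d}.
Implicit Types x y : A.

Definition C_ x : set A := [set y | y <= x].
Definition I_ x : set A := [set y | ~ has_ubound [set x; y]].

Definition scott_interior (U : set A) : set A :=
  interior (U : set (scott_topology A)).

Definition J_ x : set A := [set y | scott_interior (I_ y) x].

End ConsistencySets.

(* Main.v *)
(* Every element of a dcpo lies below a maximal one, and a maximal [x] is
   consistent exactly with the elements below it, so [I_x = ~` C_x]. Hence
   [J_x = I_x] says that for every [y] the relatively subbasic Lawson open set
   of the maximal [z] with [~ y <= z] contains, around each of its points [x],
   the trace of the Scott open set [Int (I_ y)]. Conversely, if a Scott open [U]
   traces out exactly these [z], then an upper bound of [y] and some [u] in [U]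
   would lie below a maximal element of [U] above [y]; so [U] is included in
   [I_ y]. The last claim holds because [~` C_x] is Scott open. *)

Require Import Defs.
From mathcomp Require Import all_boot all_order.
From mathcomp Require Import wochoice.
From mathcomp Require Import all_classical topology.

Import Order.TTheory.

Local Open Scope order_scope.
Local Open Scope classical_set_scope.

(** Zorn's lemma on the elements above [x]: a nonempty chain is directed, so its supremum bounds it.
    This set is upward closed, so an element maximal in it is maximal in [A]. *)
Lemma dcpo_le_total (d : Order.disp_t) (A : bPOrderType d) (x : A) :
  dcpo A -> exists2 m, total_elements A m & x <= m.
Proof.
move=> dcpoA; pose S : {pred A} := [pred y | x <= y].
have [|||m xm mmax] := @Zorn's_lemma A <=%O S; first by move=> y _; exact: lexx.
- by move=> z y t _ _ _; exact: le_trans.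
- move=> C CS /(@wo_chainW A) Cch.
  (* Directed sets are nonempty, so the empty chain is treated apart, with bound [x]. *)
  have [[c Cc]|C0] := pselect (exists c, c \in C); last first.
    by exists x; [exact: lexx|move=> y Cy; case: C0; exists y].
  have [|s [Cs _]] := dcpoA [set` C].
    split; first by exists c.
    move=> y z Cy Cz; have /orP[yz|zy] := Cch _ _ Cy Cz.
      by exists z; split=> //; exact: lexx.
    by exists y; split=> //; exact: lexx.
  exists s; last by move=> y Cy; exact: Cs.
  exact: le_trans (CS _ Cc) (Cs _ Cc).
exists m => // y my; apply: mmax => //.
exact: le_trans xm my.
Qed.

Section Consistency.
Context {d : Order.disp_t} {A : porderType d}.
Implicit Types x y : A.

Lemma has_ubound2P x y :
  has_ubound [set x; y] <-> exists2 z, x <= z & y <= z.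
Proof.
split=> [[z ub]|[z xz yz]]; first by exists z; apply: ub; [left|right].
by exists z => _ [->|->].
Qed.

Lemma I_totalE x : total_elements A x -> I_ x = ~` C_ x.
Proof.
move=> xmax; rewrite predeqE => y; rewrite /I_ /C_ /=.
split=> nxy.
  move=> yx; apply/nxy/has_ubound2P.
  by exists x => //; exact: lexx.
by move=> /has_ubound2P[z /xmax zx yz]; apply: nxy; exact: le_trans yz zx.
Qed.

(** A set that misses the complement of [C_ x] has [x] as an upper bound, so its supremum is below
    [x]. *)
Lemma scott_open_setC_C x : scott_open (~` C_ x).
Proof.
split=> [y z nyx yz zx|S s _ [_ sS] nsx]; first exact/nyx/(le_trans yz).
apply: contrapT => S0; apply/nsx/sS => t St.
by apply: contrapT => ntx; apply: S0; exists t.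
Qed.

Lemma scott_interiorP (U : set A) x :
  scott_interior U x <-> exists V, [/\ scott_open V, V x & V `<=` U].
Proof.
rewrite /scott_interior /interior nbhsE.
by split=> [[V [oV Vx] VU]|[V [oV Vx VU]]]; exists V.
Qed.

Lemma scott_interior_open (U : set A) : scott_open U -> scott_interior U = U.
Proof. by move=> oU; apply: (interior_id (U : set (scott_topology A))).1. Qed.

(** An interior lies in its set, and inconsistency is symmetric. *)
Lemma sub_J_I x : J_ x `<=` I_ x.
Proof.
by move=> y /scott_interiorP[V [_ Vx /(_ _ Vx)]]; rewrite /I_ /= setUC.
Qed.

Lemma open_lawson_subbasis (U : set A) :
  lawson_subbasis U -> open (U : set (lawson_topology A)).
Proof.
move=> bU; exists [set U]; last by rewrite bigcup_set1.
by move=> _ ->; exact: finI_from1.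
Qed.

(** Preimages commute with unions and finite intersections, so the subbasis suffices. *)
Lemma continuous_to_lawson (T : topologicalType) (f : T -> lawson_topology A) :
  (forall U : set A, lawson_subbasis U -> open (f @^-1` U)) -> continuous f.
Proof.
move=> fo; apply/continuousP => _ [B sB <-].
rewrite preimage_bigcup; apply: bigcup_open => V /sB[D sD <-].
rewrite preimage_bigcap -bigsetI_fset_set ?set_fsetK//.
rewrite big_seq; apply: big_ind => [||U /sD /set_mem]; last exact: fo.
- exact: openT.
- exact: openI.
Qed.

End Consistency.

Theorem theorem12p5p1 (d : Order.disp_t) (A : bPOrderType d)
    (contA : continuous_dcpo A) :
  (lawson_condition A <-> forall x : A, total_elements A x -> J_ x = I_ x) /\
  (lawson_condition A -> forall x : A, total_elements A x ->
     C_ x `|` J_ x = C_ x `|` scott_interior (J_ x) /\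
     C_ x `|` scott_interior (J_ x) = [set: A]).
Proof.
have lawsonJ : lawson_condition A ->
    forall x : A, total_elements A x -> J_ x = I_ x.
  move=> lawA x tx; apply/seteqP; split; first exact: sub_J_I.
  rewrite I_totalE// => y nyx.
  pose W : set (set_type (total_elements A : set (lawson_topology A))) :=
    set_val @^-1` (~` [set z : A | y <= z]).
  have : open W.
    by exists (~` [set z : A | y <= z]) => //; apply: open_lawson_subbasis;
      right; exists y.
  rewrite -lawA => -[U oU UW].
  have UP z : total_elements A z -> U z <-> ~ y <= z.
    (* The equality of traces is evaluated at [z], seen as a point of the subtype. *)
    move=> tz; have := congr1 (fun V => V (SigSub (mem_set tz))) UW.
    by rewrite /W /preimage /= => ->.
  apply/scott_interiorP; exists U; split=> //; first exact/UP.
  move=> u Uu /has_ubound2P[z yz uz].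
  have [m tm zm] := @dcpo_le_total _ _ z contA.1.
  have /UP : U m by apply: oU.1 Uu _; exact: le_trans uz zm.
  by apply=> //; exact: le_trans yz zm.
split; [split=> // JI|move=> lawA x tx]; last first.
  have oJ : scott_interior (J_ x) = J_ x.
    by rewrite lawsonJ// I_totalE// scott_interior_open//; exact: scott_open_setC_C.
  by rewrite oJ lawsonJ// I_totalE// setUv.
rewrite /lawson_condition predeqE => U; split=> -[V oV VU].
  by exists V => //; apply: open_lawson_subbasis; left.
rewrite -VU.
(* The trace of [V] is its preimage under the inclusion, so continuity from the relative Scott
   topology makes it relatively Scott open. *)
suff : continuous (set_val :
    set_type (total_elements A : set (scott_topology A)) -> lawson_topology A).
  by move/continuousP; exact.
apply: continuous_to_lawson => W [oW|[y ->]]; first by exists W.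
exists (scott_interior (I_ y)); first exact: open_interior.
rewrite predeqE => -[z /= zT]; rewrite /preimage /=.
have tz := set_mem zT; split=> [Iyz yz|nyz].
  move: (interior_subset Iyz) => /has_ubound2P; apply.
  by exists z => //; exact: lexx.
(* [J_ z y] unfolds to the goal, and the hypothesis on the maximal [z] applies to it. *)
suff : J_ z y by [].
by rewrite JI// I_totalE.
Qed.
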